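(* Assume that $R=\mathbb K[x_1]_p[x_2;\sigma_2,\delta_2]_p\cdots[x_N;\sigma_N,\delta_N]_p$ is a Poisson-CGL extension of length $N$ with torus $\mathcal H$, and $k\in[1,N-1]$ is such that $\delta_{k+1}(x_k)\in\mathbb K$. Denote by $y_1,\dots,y_N$ and $\eta:[1,N]\to\mathbb Z$ the associated sequence of homogeneous Poisson-prime elements and function, and suppose $\eta(k)=\eta(k+1)$. Assume that $R$ has a second Poisson-CGL extension presentation (for the same torus $\mathcal H$) of the form $$R=\mathbb K[x_1]_p\cdots[x_{k-1};\sigma_{k-1},\delta_{k-1}]_p[x_{k+1};\sigma'_k,\delta'_k]_p[x_k;\sigma'_{k+1},\delta'_{k+1}]_p[x_{k+2};\sigma_{k+2},\delta_{k+2}]_p\cdots[x_N;\sigma_N,\delta_N]_p,$$ and let $y'_1,\dots,y'_N$ be its associated sequence of homogeneous Poisson-prime elements (so $y'_j=y_j$ for $j\neq k$). For $I\subseteq[1,N]$ let $E_I$ (resp. $E'_I$) be the multiplicative set of all nonzero scalar multiples of monomials $\prod_{j\in I}y_j^{m_j}$ (resp. $\prod_{j\in I}(y'_j)^{m_j}$), $m_j\in\mathbb Z_{\ge0}$; let $E=E_{[1,N]}$, $E'=E'_{[1,N]}$. Let $$y_1^{m_1}\cdots y_N^{m_N}\quad\text{and}\quad y_1^{m'_1}\cdots y_{k-1}^{m'_{k-1}}(y'_k)^{m'_k}y_{k+1}^{m'_{k+1}}\cdots y_N^{m'_N}$$ be two minimal denominators of a nonzero element $v\in R[E^{-1}]\cap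 R[(E')^{-1}]$ (with respect to the two different localizations). Then $$m_k=m'_k=0\quad\text{and}\quad m_j=m'_j\ \ \forall j\in[1,N],\ j\neq k.$$ In particular, $$R[(E_I)^{-1}]\cap R[(E'_{I'})^{-1}]=R[(E_I\cap E'_{I'})^{-1}]=R[(E_{(I\cap I')\setminus\{k\}})^{-1}]$$ for all $I,I'\subseteq[1,N]$.
   Context: All localizations are inside $\mathrm{Fract}(R)$. With all $m_j\in\mathbb Z_{\ge0}$, $y_1^{m_1}\cdots y_N^{m_N}$ is a minimal denominator of a nonzero $v\in R[E^{-1}]$ if $v=y_1^{-m_1}\cdots y_N^{-m_N}s$ for some $s\in R$ such that $y_j\nmid s$ in $R$ for all $j$ with $m_j>0$; minimal denominators with respect to $E'$ are defined likewise with the $y'_j$. $\mathbb K$ is a field of characteristic $0$; algebras are $\mathbb K$-algebras, derivations are $\mathbb K$-linear; $[j,k]=\{j,\dots,k\}$. A Poisson algebra is a commutative algebra with a Lie bracket $\{-,-\}$ that is a derivation in each variable. A Poisson action is an action by algebra automorphisms preserving the bracket. A Poisson derivation $\sigma$ of $B$ is a derivation for both product and bracket; a Poisson $\sigma$-derivation is a derivation $\delta$ for the product with $\delta(\{a,b\})=\{\delta(a),b\}+\{a,\delta(b)\}+\sigma(a)\delta(b)-\delta(a)\sigma(b)$. The Poisson-Ore extension $B[x;\sigma,\delta]_p$ is $B[x]$ with the unique Poisson bracket extending that of $B$ with $\{x,b\}=\sigma(b)x+\delta(b)$. For a rational action of a torus $\mathcal H\cong(\mathbb K^* )^r$, homogeneous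 elements are the $\mathcal H$-eigenvectors and $0$; $\mathrm{Lie}\,\mathcal H\cong\mathbb K^r$ acts by the differential: if $a$ is an $\mathcal H$-eigenvector with eigenvalue $h\mapsto h_1^{u_1}\cdots h_r^{u_r}$, then $\xi\cdot a=(u_1\xi_1+\dots+u_r\xi_r)a$. A Poisson-prime element of a Poisson domain $A$ is a nonzero $c$ with $\{c,A\}\subseteq Ac$ and $A/(c)$ a domain. A Poisson-CGL (P-CGL) extension of length $N$ is an iterated Poisson-Ore extension $R=\mathbb K[x_1]_p[x_2;\sigma_2,\delta_2]_p\cdots[x_N;\sigma_N,\delta_N]_p$ ($\sigma_1=\delta_1=0$; $R_k:=\mathbb K[x_1,\dots,x_k]$, $R_0=\mathbb K$) with a rational Poisson action of a torus $\mathcal H$ such that (i) each $x_k$ is an $\mathcal H$-eigenvector; (ii) for $k\in[2,N]$, $\delta_k$ is a locally nilpotent Poisson $\sigma_k$-derivation of $R_{k-1}$; (iii) for $k\in[1,N]$ there is $h_k\in\mathrm{Lie}\,\mathcal H$ with $\sigma_k=(h_k\cdot)|_{R_{k-1}}$ and the $h_k$-eigenvalue $\lambda_k$ of $x_k$ is nonzero. For $\eta:[1,N]\to\mathbb Z$: $p(k)=\max\{j<k\mid\eta(j)=\eta(k)\}$, $s(k)=\min\{j>k\mid\eta(j)=\eta(k)\}$ ($\max\varnothing=-\infty$, $\min\varnothing=+\infty$). For every P-CGL extension there exist $\eta$ and homogeneous $c_k\in R_{k-1}$ (for $p(k)\neq-\infty$) such that the elements $y_k:=y_{p(k)}x_k-c_k$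 if $p(k)\ne-\infty$, $y_k:=x_k$ if $p(k)=-\infty$, are homogeneous and for every $k$ the set $\{y_j\mid j\in[1,k],\,s(j)>k\}$ is a list of the homogeneous Poisson-prime elements of $R_k$ up to scalar multiples; the $y_k$, the level sets of $\eta$, and $p,s$ are uniquely determined by the presentation. These are the sequence and function ''associated to'' a presentation (for the second presentation, $x_{k+1}$ is the $k$-th and $x_k$ the $(k+1)$-st adjoined variable). *)

(* Defs.v *)
From HB Require Import structures.
From mathcomp Require Import all_boot all_order all_algebra.
From mathcomp Require Import fraction.
From mathcomp Require Import mpoly.

Set Implicit Arguments.
Unset Strict Implicit.
Unset Printing Implicit Defensive.

Import GRing.Theory.
Local Open Scope ring_scope.

(* Indices are 0-based: [x i], [i : 'I_N], is the variable usually written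
   x_(i+1), and [gen x k] below is R_k = K[x_1, ..., x_k].  Subalgebras are
   predicates [R -> Prop]; maps defined on a subalgebra are represented by
   functions on the whole of R, of which only the values on the subalgebra
   matter. *)

Section PoissonAlgebra.
Variables (K : fieldType) (R : comAlgType K).
Implicit Types (br : R -> R -> R) (B A : R -> Prop) (sg dl : R -> R).

Record poisson_bracket br : Prop := PoissonBracket {
  pbr_linear : forall (c : K) a b d, br (c *: a + b) d = c *: br a d + br b d;
  pbr_alt : forall a, br a a = 0;
  pbr_skew : forall a b, br a b = - br b a;
  pbr_jacobi : forall a b d, br a (br b d) + br b (br d a) + br d (br a b) = 0;
  pbr_leibniz : forall a b d, br a (b * d) = br a b * d + b * br a d }.

Definition derivation_on B dl : Prop :=
  [/\ forall a, B a -> B (dl a),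
      forall (c : K) a b, B a -> B b -> dl (c *: a + b) = c *: dl a + dl b
    & forall a b, B a -> B b -> dl (a * b) = dl a * b + a * dl b].

Definition poisson_derivation_on br B sg : Prop :=
  derivation_on B sg /\
  forall a b, B a -> B b -> sg (br a b) = br (sg a) b + br a (sg b).

Definition poisson_sderivation_on br B sg dl : Prop :=
  derivation_on B dl /\
  forall a b, B a -> B b ->
    dl (br a b) = br (dl a) b + br a (dl b) + sg a * dl b - dl a * sg b.

Definition locally_nilpotent_on B dl : Prop :=
  forall a, B a -> exists n : nat, iter n dl a = 0.

(* A = B[z], with z transcendental over B. *)
Definition polynomial_ext B (z : R) A : Prop :=
  (forall a, A a <-> exists p : {poly R}, (forall i, B p`_i) /\ a = p.[z]) /\
  (forall p : {poly R}, (forall i, B p`_i) -> p.[z] = 0 -> p = 0).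

(* A = B[z; sg, dl]_p inside the Poisson algebra (R, br). *)
Record poisson_ore_ext br B (z : R) sg dl A : Prop := PoissonOreExt {
  pore_closed : forall a b, B a -> B b -> B (br a b);
  pore_sigma : poisson_derivation_on br B sg;
  pore_delta : poisson_sderivation_on br B sg dl;
  pore_poly : polynomial_ext B z A;
  pore_bracket : forall b, B b -> br z b = sg b * z + dl b }.

Definition divides_in B (d a : R) : Prop := exists2 b, B b & a = b * d.

(* The last two conditions say that B / (c) is a domain. *)
Record poisson_prime_in br B (c : R) : Prop := PoissonPrimeIn {
  pprime_in : B c;
  pprime_neq0 : c != 0;
  pprime_normal : forall a, B a -> divides_in B c (br c a);
  pprime_proper : ~ divides_in B c 1;
  pprime_mul : forall a b, B a -> B b -> divides_in B c (a * b) ->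
    divides_in B c a \/ divides_in B c b }.

End PoissonAlgebra.

Section TorusAction.
Variables (K : fieldType) (R : comAlgType K) (r : nat).

(* The torus (K^* )^r is the set of points h of K^r satisfying [in_torus];
   only the values of an action at such h matter. *)
Implicit Types (h g : {ffun 'I_r -> K}) (u : 'I_r -> int).
Implicit Type act : {ffun 'I_r -> K} -> R -> R.

Definition in_torus h : Prop := forall i, h i != 0.
Definition torus_one : {ffun 'I_r -> K} := [ffun=> 1].
Definition torus_mul h g : {ffun 'I_r -> K} := [ffun i => h i * g i].
Definition torus_char u h : K := \prod_(i < r) h i ^ u i.

(* [ract_rational]: every orbit map h |-> h . a is a regular function on the
   torus, i.e. a Laurent polynomial in h with coefficients in R. *)
Record rational_poisson_action (br : R -> R -> R) act : Prop :=
  RationalPoissonAction {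
  ract_one : forall a, act torus_one a = a;
  ract_mul : forall h g a, in_torus h -> in_torus g ->
    act (torus_mul h g) a = act h (act g a);
  ract_linear : forall h (c : K) a b, in_torus h ->
    act h (c *: a + b) = c *: act h a + act h b;
  ract_alg1 : forall h, in_torus h -> act h 1 = 1;
  ract_algM : forall h a b, in_torus h -> act h (a * b) = act h a * act h b;
  ract_bracket : forall h a b, in_torus h ->
    act h (br a b) = br (act h a) (act h b);
  ract_rational : forall a, exists s : seq (('I_r -> int) * R),
    forall h, in_torus h ->
      act h a = \sum_(ub <- s) torus_char ub.1 h *: ub.2 }.

Definition eigenvector act (a : R) : Prop :=
  a != 0 /\ forall h, in_torus h -> exists lam : K, act h a = lam *: a.

Definition homogeneous act (a : R) : Prop := a = 0 \/ eigenvector act a.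

Definition has_weight act u (a : R) : Prop :=
  forall h, in_torus h -> act h a = torus_char u h *: a.

(* D is the action of the point xi of Lie((K^* )^r) = K^r.  For a rational
   action the weight vectors span R, so D is determined by xi. *)
Definition lie_action act (xi : 'I_r -> K) (D : {linear R -> R}) : Prop :=
  forall u a, has_weight act u a ->
    D a = (\sum_(i < r) (u i)%:~R * xi i) *: a.

End TorusAction.

Section PCGL.
Variables (K : fieldType) (R : comAlgType K) (r N : nat).
Variables (br : R -> R -> R) (act : {ffun 'I_r -> K} -> R -> R).
Variable x : 'I_N -> R.

Inductive gen (k : nat) : R -> Prop :=
| gen_scalar (c : K) : gen k c%:A
| gen_var (i : 'I_N) : (i < k)%N -> gen k (x i)
| gen_add a b : gen k a -> gen k b -> gen k (a + b)
| gen_mul a b : gen k a -> gen k b -> gen k (a * b).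

(* At the first step the base is R_0 = K, on which every K-linear derivation
   vanishes: the conditions there amount to sigma_1 = delta_1 = 0. *)
Record pcgl_extension (sg dl : 'I_N -> R -> R) : Prop := PCGLExtension {
  pcgl_poisson : poisson_bracket br;
  pcgl_top : forall a, gen N a;
  pcgl_ore : forall k : 'I_N,
    poisson_ore_ext br (gen k) (x k) (sg k) (dl k) (gen k.+1);
  pcgl_action : rational_poisson_action br act;
  pcgl_eigen : forall k, eigenvector act (x k);
  pcgl_nilpotent : forall k : 'I_N, locally_nilpotent_on (gen k) (dl k);
  pcgl_lie : forall k : 'I_N, exists (xi : 'I_r -> K) (D : {linear R -> R}),
    [/\ lie_action act xi D,
        forall b, gen k b -> sg k b = D b
      & exists2 lam : K, lam != 0 & D (x k) = lam *: x k] }.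

(* p(k) and s(k); None stands for -oo, resp. +oo. *)
Definition level_pred (eta : 'I_N -> int) (k : 'I_N) : option 'I_N :=
  [pick j : 'I_N | [&& (j < k)%N, eta j == eta k
    & [forall i : 'I_N, ((i < k)%N && (eta i == eta k)) ==> (i <= j)%N]]].

Definition level_succ (eta : 'I_N -> int) (k : 'I_N) : option 'I_N :=
  [pick j : 'I_N | [&& (k < j)%N, eta j == eta k
    & [forall i : 'I_N, ((k < i)%N && (eta i == eta k)) ==> (j <= i)%N]]].

Definition level_succ_gt (eta : 'I_N -> int) (j k : 'I_N) : bool :=
  if level_succ eta j is Some l then (k < l)%N else true.

Record associated_primes (eta : 'I_N -> int) (y : 'I_N -> R) : Prop :=
  AssociatedPrimes {
  assoc_rec : forall k : 'I_N,
    match level_pred eta k with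
    | Some j => exists c : R,
        [/\ homogeneous act c, gen k c & y k = y j * x k - c]
    | None => y k = x k
    end;
  assoc_homogeneous : forall k, homogeneous act (y k);
  assoc_primes : forall (k : 'I_N) (a : R),
    (homogeneous act a /\ poisson_prime_in br (gen k.+1) a) <->
    exists (j : 'I_N) (c : K),
      [/\ (j <= k)%N, level_succ_gt eta j k, c != 0 & a = c *: y j] }.

Definition monomial_in (y : 'I_N -> R) (I : {set 'I_N}) (e : R) : Prop :=
  exists (c : K) (m : 'I_N -> nat),
    c != 0 /\ e = c *: \prod_(j in I) y j ^+ m j.

End PCGL.

Section Localization.
Variable R : idomainType.

Definition localization (E : R -> Prop) (v : {fraction R}) : Prop :=
  exists (s e : R), E e /\ v = tofrac s / tofrac e.

Definition minimal_denominator (N : nat) (y : 'I_N -> R) (m : 'I_N -> nat)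
    (v : {fraction R}) : Prop :=
  exists s : R,
    v = (tofrac (\prod_(j < N) y j ^+ m j))^-1 * tofrac s /\
    forall j, (0 < m j)%N -> ~ exists b : R, s = b * y j.

End Localization.

(* Main.v *)
Require Import Defs.
From HB Require Import structures.
From mathcomp Require Import all_boot all_order all_algebra all_fingroup.
From mathcomp Require Import fraction.
From mathcomp Require Import mpoly.
From mathcomp Require Import ring.

(** Indices count from 0, R_j stands for [gen x j] and p for [level_pred eta],
    so that y_j = y_p(j) x_j - c_j lies in R_(j+1).

    The elements y_j together with y'_k are pairwise non-associated prime
    elements of the ring R, and the theorem expresses the uniqueness of the
    lowest terms of a fraction whose denominator is a product of such primes.

    Primality.  y_j is prime in R_(j+1), and R is an iterated polynomial ring
    over R_(j+1), so y_j is prime in R by Gauss's lemma ([prime_in_poly],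
    [prime_in_top]).  Moreover y_j is not in R_j, since x_j has a nonzero
    coefficient in it; as the units of R are scalars, distinct y_j are not
    associated.

    Comparison of the two presentations.  Both pass through the same
    subalgebras R_j, except R_(k+1).  Hence for j <> k, k+1 the elements y_j
    and y'_j are both, up to a scalar, the homogeneous Poisson-prime element of
    R_(j+1) outside R_j.  Their coefficients of x_j are 1 or members of the
    sequence, and two such elements can only be proportional when they are
    equal, so the scalar is 1 ([assoc_swap_step]).  For j = k+1 the last
    variables of the two presentations differ; there one compares the
    coefficients of x_k x_(k+1), which also yields eta'(k) = eta'(k+1)
    ([assoc_swap_k1]).  Finally y'_k involves x_(k+1) and y_k does not.

    Denominators.  If v = s / y^m = s' / y'^m' then y'^m' s = y^m s'.  When y_j
    does not divide s, its exponent m_j is at most the exponent of y_j in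
    y'^m', which is m'_j for j <> k and 0 for j = k ([exchanged_exponents]);
    the roles of y and y' may be exchanged.  Similarly, if v = s / e = s' / e'
    with e in E_I and e' in E'_I', the factors y_j of e with j outside
    (I & I') \ k are prime and do not divide e', so they divide s and cancel
    ([exchanged_cancels], [localization_exchanged]). *)

Set Implicit Arguments.
Unset Strict Implicit.
Unset Printing Implicit Defensive.

Import GRing.Theory.
Local Open Scope ring_scope.

(** * Prime elements of subalgebras *)

Record prime_in (K : fieldType) (R : comAlgType K) (B : R -> Prop) (c : R) :
    Prop := PrimeIn {
  prime_in_mem : B c;
  prime_in_proper : ~ divides_in B c 1;
  prime_in_mul : forall a b, B a -> B b -> divides_in B c (a * b) ->
    divides_in B c a \/ divides_in B c b }.

Lemma eq_poisson_prime (K : fieldType) (R : comAlgType K)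
    (br : R -> R -> R) (A B : R -> Prop) (c : R) :
  (forall a, A a <-> B a) -> poisson_prime_in br A c -> poisson_prime_in br B c.
Proof.
move=> AB [cA c0 cn cp cm].
have D d a : divides_in A d a <-> divides_in B d a.
  by split=> -[b /AB hb ->]; exists b.
split=> //; first exact/AB.
- by move=> a /AB /cn /D.
- by move=> /D.
- by move=> a b /AB ha /AB hb /D /(cm a b ha hb) [] /D; [left|right].
Qed.

(** * Predecessors and successors in a level set *)

Lemma level_predP N (eta : 'I_N -> int) (k j : 'I_N) :
  level_pred eta k = Some j ->
  [/\ (j < k)%N, eta j = eta k
    & forall i : 'I_N, (i < k)%N -> eta i = eta k -> (i <= j)%N].
Proof.
rewrite /level_pred; case: pickP => // i /and3P[ik /eqP e /forallP h] [<-].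
by split=> // l lk el; have := h l; rewrite lk el eqxx.
Qed.

Lemma level_pred_consecutive N (eta : 'I_N -> int) (k k1 : 'I_N) :
  k1 = k.+1 :> nat -> eta k = eta k1 -> level_pred eta k1 = Some k.
Proof.
move=> hk1 e; rewrite /level_pred; case: pickP => [i|/(_ k)].
  case/and3P=> ik _ /forallP /(_ k); rewrite hk1 ltnS leqnn e eqxx /= => ki.
  by congr Some; apply/val_inj/eqP; rewrite eqn_leq ki andbT -ltnS -hk1.
rewrite hk1 ltnS leqnn e eqxx /= => /forallP[] i.
by apply/implyP=> /andP[]; rewrite ltnS.
Qed.

Lemma level_succ_gt_refl N (eta : 'I_N -> int) (j : 'I_N) :
  level_succ_gt eta j j.
Proof.
by rewrite /level_succ_gt /level_succ; case: pickP => // i /and3P[].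
Qed.

Lemma level_succ_gt_consecutive N (eta : 'I_N -> int) (k k1 : 'I_N) :
  k1 = k.+1 :> nat -> eta k = eta k1 -> ~~ level_succ_gt eta k k1.
Proof.
move=> hk1 e; rewrite /level_succ_gt /level_succ; case: pickP => [i|/(_ k1)].
  case/and3P=> _ _ /forallP /(_ k1).
  by rewrite hk1 leqnn e eqxx /= -hk1 -leqNgt.
rewrite hk1 leqnn e eqxx /= => /forallP[] i.
by apply/implyP=> /andP[].
Qed.

(** * Iterated polynomial extensions *)

Section Tower.
Variables (K : fieldType) (R : comAlgType K) (N : nat) (x : 'I_N -> R).

Lemma gen_alg n (c : K) : gen x n c%:A. Proof. exact: gen_scalar. Qed.

Lemma gen1 n : gen x n 1.
Proof. by have := gen_alg n 1; rewrite scale1r. Qed.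

Lemma gen0 n : gen x n 0.
Proof. by have := gen_alg n 0; rewrite scale0r. Qed.

Lemma genZ n (c : K) a : gen x n a -> gen x n (c *: a).
Proof.
by move=> ha; rewrite -[a]mul1r scalerAl; apply: gen_mul => //; apply: gen_alg.
Qed.

Lemma genB n a b : gen x n a -> gen x n b -> gen x n (a - b).
Proof. by move=> ha hb; rewrite -scaleN1r; apply/gen_add/genZ. Qed.

Lemma gen_subset (x' : 'I_N -> R) m n a :
  (forall i : 'I_N, (i < m)%N -> gen x n (x' i)) -> gen x' m a -> gen x n a.
Proof.
move=> h; elim=> {a} [c|i /h //|a b _ ha _ hb|a b _ ha _ hb].
- exact: gen_alg.
- exact: gen_add.
- exact: gen_mul.
Qed.

Lemma gen_mono m n a : (m <= n)%N -> gen x m a -> gen x n a.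
Proof.
by move=> mn; apply: gen_subset => i im; apply/gen_var/(leq_trans im).
Qed.

Hypothesis hpoly : forall i : 'I_N,
  polynomial_ext (gen x i) (x i) (gen x i.+1).

(** x_i is transcendental over R_i.  This is how coefficients of x_i are
    compared in elements that have degree at most 1 in x_i. *)
Lemma gen_affine0 (i : 'I_N) a b :
  gen x i a -> gen x i b -> a * x i - b = 0 -> a = 0.
Proof.
move=> ha hb e; have [_ /(_ (a%:P * 'X - b%:P))] := hpoly i.
rewrite !hornerE => /(_ _ e) h.
have {h} : a%:P * 'X - b%:P = 0 :> {poly R}.
  apply: h => -[|[|n]]; rewrite coefB coefMX !coefC /= ?subr0 ?sub0r //.
  - by rewrite -[- b]sub0r; apply/genB/hb/gen0.
  - exact: gen0.
move=> /(congr1 (fun p : {poly R} => p`_1)).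
by rewrite coefB coefMX !coefC subr0.
Qed.

(** Reduces divisibility in R_(i+1) by an element of R_i to divisibility of
    coefficients, which is the form that Gauss's lemma needs. *)
Lemma horner_divides (i : 'I_N) (c : R) (p : {poly R}) :
  gen x i c -> (forall j, gen x i p`_j) ->
  divides_in (gen x i.+1) c p.[x i] <->
  forall j, divides_in (gen x i) c p`_j.
Proof.
move=> hc hp; have [hA inj] := hpoly i; split.
  case=> b /hA[q [hq ->]] e j; exists q`_j => //.
  suff : p - q * c%:P = 0.
    move=> /(congr1 (fun p : {poly R} => p`_j)).
    by rewrite coefB coefMC coef0 => /eqP; rewrite subr_eq0 => /eqP.
  apply: inj => [l|]; last by rewrite !hornerE e subrr.
  by rewrite coefB coefMC; apply/genB => //; apply: gen_mul.
elim/poly_ind: p {hp} => [|p a IH] D.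
  by exists 0; [exact: gen0|rewrite horner0 mul0r].
have [j|b hb eb] := IH.
  by have := D j.+1; rewrite coefD coefMX coefC /= addr0.
have [] := D 0%N; rewrite coefD coefMX coefC /= add0r => d hd ed.
exists (b * x i + d); last by rewrite !hornerE eb ed; ring.
apply: gen_add; last exact: gen_mono hd.
by apply: gen_mul => //; apply: gen_var.
Qed.

(** Gauss's lemma: a product of two nonzero polynomials over the domain R_n / c
    is nonzero.  The induction removes the constant terms of p and q: c divides
    one of them, and the polynomial it belongs to may be replaced by its
    quotient by the variable. *)
Lemma prime_in_poly n (c : R) (p q : {poly R}) :
  prime_in (gen x n) c ->
  (forall i, gen x n p`_i) -> (forall i, gen x n q`_i) ->
  (forall i, divides_in (gen x n) c (p * q)`_i) ->
  (forall i, divides_in (gen x n) c p`_i) \/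
  (forall i, divides_in (gen x n) c q`_i).
Proof.
move=> [hc _ cm].
have div0 : divides_in (gen x n) c 0 by exists 0; [exact: gen0|rewrite mul0r].
have coefXS (a : R) (s : {poly R}) i : (s * 'X + a%:P)`_i.+1 = s`_i.
  by rewrite coefD coefMX coefC addr0.
have coefX0 (a : R) (s : {poly R}) : (s * 'X + a%:P)`_0 = a.
  by rewrite coefD coefMX coefC add0r.
have tail (a : R) (s t : {poly R}) : (forall i, gen x n t`_i) ->
    (forall i, divides_in (gen x n) c ((s * 'X + a%:P) * t)`_i) ->
    divides_in (gen x n) c a -> forall i, divides_in (gen x n) c (s * t)`_i.
  move=> ht D [d hd ea] i; rewrite {a}ea in D; have [b hb e] := D i.+1.
  exists (b - d * t`_i.+1); first by apply/genB => //; apply: gen_mul.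
  rewrite mulrBl -e; have -> : (s * 'X + (d * c)%:P) * t
    = s * t * 'X + (d * c)%:P * t by ring.
  by rewrite coefD coefMX coefCM /=; ring.
have cons (a : R) (s : {poly R}) : divides_in (gen x n) c a ->
    (forall i, divides_in (gen x n) c s`_i) ->
    forall i, divides_in (gen x n) c (s * 'X + a%:P)`_i.
  by move=> ha hs [|i]; rewrite ?coefX0 ?coefXS.
elim/poly_ind: p q => [|p a IHp] q; first by left=> i; rewrite coef0.
move=> hp; have hp' i : gen x n p`_i by have := hp i.+1; rewrite coefXS.
have ha : gen x n a by have := hp 0%N; rewrite coefX0.
elim/poly_ind: q => [|q b IHq]; first by right=> i; rewrite coef0.
move=> hq; have hq' i : gen x n q`_i by have := hq i.+1; rewrite coefXS.
have hb : gen x n b by have := hq 0%N; rewrite coefX0.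
move=> D; have := D 0%N; rewrite coef0M !coefX0 => /(cm _ _ ha hb) [ca|cb].
  have [] := IHp _ hp' hq (tail _ _ _ hq D ca); last by right.
  by left; apply: cons.
rewrite mulrC in D; have := tail _ _ _ hp D cb; rewrite mulrC => D'.
by have [] := IHq hq' D'; [left|right; apply: cons].
Qed.

Lemma prime_in_next (i : 'I_N) c :
  prime_in (gen x i) c -> prime_in (gen x i.+1) c.
Proof.
move=> pc; have [hc cp _] := pc; have [hA _] := hpoly i.
split; first exact: gen_mono hc.
  have h1 j : gen x i (1%:P : {poly R})`_j.
    by rewrite coefC; case: ifP => _; [exact: gen1|exact: gen0].
  have -> : 1 = (1%:P : {poly R}).[x i] by rewrite hornerC.
  by move/(horner_divides hc h1)/(_ 0%N); rewrite coefC.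
move=> _ _ /hA[p [hp ->]] /hA[q [hq ->]]; rewrite -hornerM.
have hpq j : gen x i (p * q)`_j.
  by rewrite coefM; apply: big_ind => [||l _]; [exact: gen0|exact: gen_add|
    exact: gen_mul].
move/(horner_divides hc hpq)/(prime_in_poly pc hp hq).
by case=> D; [left|right]; apply/horner_divides.
Qed.

Lemma prime_in_top m n c :
  (m <= n <= N)%N -> prime_in (gen x m) c -> prime_in (gen x n) c.
Proof.
case/andP; elim: n => [|n IH]; first by rewrite leqn0 => /eqP ->.
rewrite leq_eqVlt => /predU1P[<- //|mn nN pc].
exact: (prime_in_next (i := Ordinal nN) (IH mn (ltnW nN) pc)).
Qed.

(** * The primes associated to one presentation *)

Section Associated.
Variables (r : nat) (br : R -> R -> R) (act : {ffun 'I_r -> K} -> R -> R).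
Variables (eta : 'I_N -> int) (y : 'I_N -> R).
Hypothesis hy : associated_primes br act x eta y.

Lemma assoc_poisson_prime (j : 'I_N) : poisson_prime_in br (gen x j.+1) (y j).
Proof.
apply: proj2; apply/(assoc_primes hy); exists j, 1.
by rewrite scale1r oner_neq0 leqnn level_succ_gt_refl.
Qed.

Lemma assoc_neq0 (j : 'I_N) : y j != 0.
Proof. exact: pprime_neq0 (assoc_poisson_prime j). Qed.

Lemma assoc_prime_in (j : 'I_N) : prime_in (gen x j.+1) (y j).
Proof. by case: (assoc_poisson_prime j). Qed.

Lemma assoc_gen (j : 'I_N) n : (j < n)%N -> gen x n (y j).
Proof.
by move=> jn; apply: gen_mono jn (pprime_in (assoc_poisson_prime j)).
Qed.

(** The coefficient of x_j in y_j; it serves to treat both cases of the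
    recursion at once. *)
Definition lead (j : 'I_N) : R := if level_pred eta j is Some i then y i else 1.

Lemma lead_gen (j : 'I_N) : gen x j (lead j).
Proof.
rewrite /lead; case e: (level_pred eta j) => [i|]; last exact: gen1.
by have [ij _ _] := level_predP e; apply: assoc_gen.
Qed.

Lemma lead_neq0 (j : 'I_N) : lead j != 0.
Proof.
by rewrite /lead; case: level_pred => [i|]; rewrite ?assoc_neq0 ?oner_neq0.
Qed.

Lemma assoc_lead (j : 'I_N) :
  exists2 c, gen x j c & y j = lead j * x j - c.
Proof.
rewrite /lead; have := assoc_rec hy j.
case: level_pred => [i [c [_ hc ->]]|->]; first by exists c.
by exists 0; [exact: gen0|rewrite mul1r subr0].
Qed.

Lemma assoc_notin (j : 'I_N) : ~ gen x j (y j).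
Proof.
move=> h; have [c hc e] := assoc_lead j; case/eqP: (lead_neq0 j).
apply: (gen_affine0 (lead_gen j) (gen_add hc h)).
by rewrite e; ring.
Qed.

(** The index j is recovered from the line through y_j as the last step of the
    tower at which y_j is not yet present. *)
Lemma assoc_scale_inj (a : K) (i j : 'I_N) : y i = a *: y j -> i = j.
Proof.
have no (b : K) (l m : 'I_N) : y l = b *: y m -> ~~ (m < l)%N.
  by move=> e; apply/negP=> ml; apply: (@assoc_notin l); rewrite e;
     apply/genZ/assoc_gen.
move=> e; apply/val_inj/eqP; rewrite eqn_leq leqNgt (no _ _ _ e) /=.
rewrite leqNgt; apply: (no a^-1); rewrite e scalerA mulVf ?scale1r //.
by apply: contraNneq (assoc_neq0 i) => a0; rewrite e a0 scale0r.
Qed.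

Definition one_or_assoc (u : R) : Prop := u = 1 \/ exists i, u = y i.

Lemma one_or_assoc_lead (j : 'I_N) : one_or_assoc (lead j).
Proof.
by rewrite /lead; case: level_pred => [i|]; [right; exists i|left].
Qed.

Lemma assoc_scale_neq1 (a : K) (i : 'I_N) : a *: y i <> 1.
Proof.
move=> e; case: (prime_in_proper (assoc_prime_in i)); exists a%:A.
  exact: gen_alg.
by rewrite -scalerAl mul1r e.
Qed.

(** Fixes the scalar left free by [assoc_primes]: proportional leading
    coefficients are equal, since no y_i is a scalar and no two of them are
    proportional. *)
Lemma one_or_assoc_scale (a : K) (u w : R) :
  one_or_assoc u -> one_or_assoc w -> u = a *: w -> a = 1.
Proof.
have cancel (z : R) : z != 0 -> z = a *: z -> a = 1.
  move=> z0 /eqP; rewrite -{1}[z]scale1r -subr_eq0 -scalerBl scaler_eq0.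
  by rewrite (negPf z0) orbF subr_eq0 eq_sym => /eqP.
case=> [->|[i ->]] [->|[j ->]] e.
- exact: (cancel _ (oner_neq0 _) e).
- by case: (@assoc_scale_neq1 a j).
- have a0 : a != 0.
    by apply: contraNneq (assoc_neq0 i) => a0; rewrite e a0 scale0r.
  by case: (@assoc_scale_neq1 a^-1 i); rewrite e scalerA mulVf ?scale1r.
- by move: e (assoc_scale_inj e) => /[swap] <-; apply/cancel/assoc_neq0.
Qed.

(** The list of homogeneous Poisson primes of R_(j+1) consists of y_j and of
    some earlier y_i, so excluding the latter leaves only y_j. *)
Lemma poisson_prime_scale (j : 'I_N) (z : R) :
  homogeneous act z -> poisson_prime_in br (gen x j.+1) z ->
  (forall i : 'I_N, (i < j)%N -> level_succ_gt eta i j ->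
     forall a : K, z <> a *: y i) ->
  exists2 a : K, a != 0 & z = a *: y j.
Proof.
move=> hz pz no; have /(assoc_primes hy) := conj hz pz.
case=> i [c [ij si c0 e]]; exists c => //.
move: ij; rewrite leq_eqVlt => /predU1P[/val_inj <- //|ij].
by case: (no i ij si c e).
Qed.

End Associated.
End Tower.

(** * Comparing the two presentations *)

Section Compare.
Variables (K : fieldType) (R : comAlgType K) (N r : nat).
Variables (br : R -> R -> R) (act : {ffun 'I_r -> K} -> R -> R).
Variables (x x' : 'I_N -> R) (k k1 : 'I_N).
Hypothesis hk1 : k1 = k.+1 :> nat.
Hypothesis hx' : forall j, x' j = x (tperm k k1 j).
Hypothesis hpoly : forall i : 'I_N,
  polynomial_ext (gen x i) (x i) (gen x i.+1).
Hypothesis hpoly' : forall i : 'I_N,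
  polynomial_ext (gen x' i) (x' i) (gen x' i.+1).
Variables (eta eta' : 'I_N -> int) (y y' : 'I_N -> R).
Hypothesis hy : associated_primes br act x eta y.
Hypothesis hy' : associated_primes br act x' eta' y'.
Hypothesis heta : eta k = eta k1.

Lemma gen_swap n a : (n != k.+1)%N -> gen x' n a <-> gen x n a.
Proof.
move=> nk.
have st (i : 'I_N) : (i < n)%N -> (tperm k k1 i < n)%N.
  case: tpermP => [->|->|//]; rewrite hk1; last by move/ltnW.
  by move=> kn; rewrite ltn_neqAle eq_sym nk.
split; apply: gen_subset => i /st hi; first by rewrite hx'; apply: gen_var.
by rewrite -[i](tpermK k k1) -hx'; apply: gen_var.
Qed.

Lemma swap_fixed (j : 'I_N) : j != k -> j != k1 -> x' j = x j.
Proof. by move=> jk jk1; rewrite hx' tpermD // eq_sym. Qed.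

Lemma swap_l : x' k = x k1. Proof. by rewrite hx' tpermL. Qed.
Lemma swap_r : x' k1 = x k. Proof. by rewrite hx' tpermR. Qed.

Lemma poisson_prime_swap (j : 'I_N) c : j != k ->
  poisson_prime_in br (gen x' j.+1) c -> poisson_prime_in br (gen x j.+1) c.
Proof.
by move=> jk; apply: eq_poisson_prime => a; apply: gen_swap; rewrite eqSS.
Qed.

(** Away from k and k+1 the last variable is the same in both presentations,
    and y_j, y'_j are the Poisson primes that involve it; the hypothesis on the
    leading coefficient of y'_j is the induction hypothesis in the recursion. *)
Lemma assoc_swap_step (j : 'I_N) : j != k -> j != k1 ->
  one_or_assoc y (lead eta' y' j) -> y' j = y j.
Proof.
move=> jk jk1 hl.
have jk' : (j : nat) != k.+1 by rewrite -hk1.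
have sw a : gen x' j a <-> gen x j a by apply: gen_swap.
have [a a0 e] : exists2 a : K, a != 0 & y' j = a *: y j.
  apply: (poisson_prime_scale hy (assoc_homogeneous hy' j)).
    by apply/poisson_prime_swap/(assoc_poisson_prime hy').
  move=> i ij _ b eb; apply: (@assoc_notin _ _ _ _ hpoly' _ _ _ _ _ hy' j).
  by rewrite eb; apply/sw/genZ/(assoc_gen hy).
have [c hc ec] := assoc_lead hy j; have [c' /sw hc' ec'] := assoc_lead hy' j.
rewrite swap_fixed // in ec'.
have hl' : gen x j (lead eta' y' j) by apply/sw/(lead_gen hy').
suff a1 : a = 1 by rewrite e a1 scale1r.
apply: (one_or_assoc_scale hpoly hy hl (one_or_assoc_lead eta y j)).
apply/eqP; rewrite -subr_eq0; apply/eqP.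
apply: (@gen_affine0 _ _ _ _ hpoly j _ (c' - a *: c)).
- by apply: genB => //; apply/genZ/(lead_gen hy).
- by apply: genB => //; apply/genZ.
have : y' j - a *: y j = 0 by rewrite e subrr.
by rewrite ec ec' scalerBr scalerAl => <-; ring.
Qed.

Lemma assoc_swap_below (j : 'I_N) : (j < k)%N -> y' j = y j.
Proof.
have [n] := ubnP (j : nat); elim: n j => // n IH j; rewrite ltnS => jn jk.
have jkN : j != k by rewrite -val_eqE neq_ltn jk.
apply: assoc_swap_step => //.
  by rewrite -val_eqE /= hk1 neq_ltn ltnS ltnW.
rewrite /lead; case e: level_pred => [i|]; last by left.
right; exists i; have [ij _ _] := level_predP e.
by apply: IH; [exact: leq_trans ij jn|exact: ltn_trans jk].
Qed.

Lemma lead_swap_k : one_or_assoc y (lead eta' y' k).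
Proof.
rewrite /lead; case e: level_pred => [i|]; last by left.
by right; exists i; have [ij _ _] := level_predP e; apply: assoc_swap_below.
Qed.

Lemma gen_k1_poly a : gen x' k.+1 a ->
  exists p : {poly R}, (forall i, gen x k p`_i) /\ a = p.[x k1].
Proof.
have [h _] := hpoly' k; case/h => p [hp ->]; exists p; split.
  by move=> i; apply/gen_swap/hp; rewrite neq_ltn ltnSn.
by rewrite swap_l.
Qed.

(** The coefficient of x_k in y'_(k+1) is 1, an earlier y_i, or y'_k.  As a
    polynomial in x_(k+1) it is affine, and it is constant except in the case
    of y'_k. *)
Lemma lead_swap_k1 : exists s t : R,
  [/\ gen x k s, gen x k t, lead eta' y' k1 = s * x k1 - t
    & s != 0 -> level_pred eta' k1 = Some k /\ s = lead eta' y' k].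
Proof.
have swk a : gen x' k a <-> gen x k a.
  by apply: gen_swap; rewrite neq_ltn ltnSn.
rewrite {1}/lead; case e: level_pred => [i|].
  have [ik1 ei _] := level_predP e.
  case: (eqVneq i k) => [ik|ik].
    have [c hc ec] := assoc_lead hy' k.
    exists (lead eta' y' k), c; split; rewrite ?ik //.
    - by apply/swk/(lead_gen hy').
    - by apply/swk.
    - by rewrite ec swap_l.
  exists 0, (- y' i); split; rewrite ?eqxx ?mul0r ?sub0r ?opprK //.
    exact: gen0.
  rewrite -[- _]sub0r; apply: genB; first exact: gen0.
  have ik' : (i < k)%N by rewrite ltn_neqAle ik -ltnS -hk1.
  by rewrite assoc_swap_below //; apply: (assoc_gen hy).
exists 0, (- 1); split; rewrite ?eqxx ?mul0r ?sub0r ?opprK //.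
  exact: gen0.
by rewrite -[- _]sub0r; apply: genB; [exact: gen0|exact: gen1].
Qed.

(** Since eta(k) = eta(k+1), y_k is not among the Poisson primes of R_(k+2),
    so y'_(k+1) = a y_(k+1).  The coefficient of x_k x_(k+1) is a y_p(k) on the
    right (a if p(k) does not exist).  It is nonzero, so the left hand side must
    have y'_k for leading coefficient, and a = 1 follows. *)
Lemma assoc_swap_k1 : y' k1 = y k1 /\ level_pred eta' k1 = Some k.
Proof.
have k1k : k1 != k by rewrite -val_eqE /= hk1 neq_ltn ltnSn orbT.
have [a a0 e] : exists2 a : K, a != 0 & y' k1 = a *: y k1.
  apply: (poisson_prime_scale hy (assoc_homogeneous hy' k1)).
    by apply/poisson_prime_swap/(assoc_poisson_prime hy').
  move=> i; rewrite hk1 ltnS leq_eqVlt.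
  case/predU1P => [/val_inj ->|ik _ b eb].
    by rewrite (negPf (level_succ_gt_consecutive hk1 heta)).
  apply: (@assoc_notin _ _ _ _ hpoly' _ _ _ _ _ hy' k1).
  rewrite eb; apply: genZ; apply: (@gen_mono _ _ _ x' k); first by rewrite hk1.
  by apply/gen_swap/(assoc_gen hy) => //; rewrite neq_ltn ltnSn.
have [b hb eb] := assoc_lead hy k.
have [c hc ec] := assoc_lead hy k1.
rewrite /lead (level_pred_consecutive hk1 heta) in ec.
have [s [t [hs ht es hst]]] := lead_swap_k1.
have [c' hc' ec'] := assoc_lead hy' k1.
rewrite hk1 in hc hc'; have {hc'}[p [hp ep]] := gen_k1_poly hc'.
rewrite es swap_r in ec'.
(* The coefficients of x_(k+1) in y'_(k+1) = a y_(k+1), over R_(k+1). *)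
have lin : s * x k - p`_1 = a *: y k.
  have hk (d : R) : gen x k d -> gen x k1 d by apply: gen_mono; rewrite hk1.
  have hxk : gen x k1 (x k) by apply: gen_var; rewrite hk1.
  have [_ inj] := hpoly k1.
  pose q : {poly R} := (s * x k - a *: y k)%:P * 'X
     + (a *: c - t * x k)%:P - p.
  have q0 : q = 0.
    apply: inj => [i|].
      rewrite /q coefB; apply: genB; last exact/hk.
      rewrite coefD coefMX !coefC; apply: gen_add.
        case: i => [|i]; first exact: gen0.
        case: i => [|i] /=; last exact: gen0.
        apply: genB; first by apply: gen_mul => //; apply: hk.
        by apply/genZ/(assoc_gen hy); rewrite hk1.
      case: i => [|i] /=; last exact: gen0.
      apply: genB; last by apply: gen_mul => //; apply: hk.
      by apply: genZ; rewrite hk1.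
    rewrite /q hornerD hornerN hornerD hornerMX !hornerC -ep.
    have : y' k1 - a *: y k1 = 0 by rewrite e subrr.
    by rewrite ec ec' scalerBr scalerAl => <-; ring.
  move/(congr1 (fun p : {poly R} => p`_1)): q0.
  rewrite /q coefB coefD coefMX !coefC /= addr0 => q1.
  by apply/eqP; rewrite -subr_eq0; apply/eqP; rewrite -[RHS]q1; ring.
(* The coefficients of x_k in [lin], over R_k. *)
have es' : s = a *: lead eta y k.
  apply/eqP; rewrite -subr_eq0; apply/eqP.
  apply: (@gen_affine0 _ _ _ _ hpoly k _ (p`_1 - a *: b)).
  - by apply: genB => //; apply/genZ/(lead_gen hy).
  - by apply: genB => //; apply/genZ.
  have : s * x k - p`_1 - a *: y k = 0 by rewrite lin subrr.
  by rewrite eb scalerBr scalerAl => e0; rewrite -[RHS]e0; ring.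
have s0 : s != 0 by rewrite es' scaler_eq0 (negPf a0) (lead_neq0 hy).
have [ek es''] := hst s0; split=> //; rewrite e.
have -> : a = 1; last by rewrite scale1r.
apply: (one_or_assoc_scale hpoly hy lead_swap_k (one_or_assoc_lead eta y k)).
by rewrite -es''.
Qed.

Lemma assoc_swap (j : 'I_N) : j != k -> y' j = y j.
Proof.
have [y1 e1] := assoc_swap_k1.
have [n] := ubnP (j : nat); elim: n j => // n IH j; rewrite ltnS => jn jk.
have [->//|jk1] := eqVneq j k1.
case: (ltngtP (j : nat) k) => [|kj|/val_inj jk0]; first exact: assoc_swap_below.
  apply: assoc_swap_step => //.
  rewrite /lead; case e: level_pred => [i|]; last by left.
  right; exists i; have [ij ei mi] := level_predP e.
  apply: IH; first exact: leq_trans ij jn.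
  (* The predecessor is not k, because k+1 < j is on the same level as k. *)
  apply/eqP=> ik; have [_ ek _] := level_predP e1.
  have := mi k1; rewrite -ek -{1}ik ei hk1 ik ltnn => h.
  suff : false by [].
  by apply: h => //; rewrite ltn_neqAle kj eq_sym -hk1 andbT.
by rewrite jk0 eqxx in jk.
Qed.

Lemma assoc_swap_neq (a : K) : y' k <> a *: y k.
Proof.
move=> e; have swk d : gen x' k d <-> gen x k d.
  by apply: gen_swap; rewrite neq_ltn ltnSn.
have [c /swk hc ec] := assoc_lead hy' k.
have up d : gen x k d -> gen x k1 d by apply: gen_mono; rewrite hk1.
case/eqP: (lead_neq0 hy' k).
apply: (@gen_affine0 _ _ _ _ hpoly k1 _ (c + a *: y k)).
- by apply/up/swk/(lead_gen hy').
- by apply: gen_add; [exact: up|apply/genZ/(assoc_gen hy); rewrite hk1].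
by rewrite -e ec -swap_l; ring.
Qed.

End Compare.

(** * Fractions over products of primes *)

Section PrimeElements.
Variable R : idomainType.
Implicit Types (p q D s T : R).

Definition divs q a : Prop := exists b, a = b * q.

Record prime_element q : Prop := PrimeElement {
  prime_element_neq0 : q != 0;
  prime_element_proper : ~ divs q 1;
  prime_element_mul : forall a b, divs q (a * b) -> divs q a \/ divs q b }.

Lemma prime_divs_prime p q b :
  prime_element p -> prime_element q -> p = b * q -> exists d, d * b = 1.
Proof.
move=> [p0 _ pm] [q0 qn _] e; have [|[d eb]|[d eq]] := pm b q.
- by exists 1; rewrite mul1r.
- case: qn; exists d; apply: (mulIf p0).
  by rewrite mul1r {1}e eb mulrAC.
- by exists d; apply: (mulIf q0); rewrite mul1r -mulrA -e.
Qed.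

Lemma prime_divs_prod (I : finType) (P : pred I) (z : I -> R) (m : I -> nat) q :
  prime_element q -> divs q (\prod_(i | P i) z i ^+ m i) ->
  exists2 i, P i & divs q (z i).
Proof.
move=> [_ qn qm].
elim/big_rec: _ => [/qn//|i a Pi IH /qm[|/IH//]].
elim: (m i) => [|n IHn]; first by rewrite expr0 => /qn.
by rewrite exprS => /qm[|/IHn //]; exists i.
Qed.

(** Stands for A being coprime to D, in a form that is visibly stable under
    products of A although R need not have gcds. *)
Definition cancels_mod D A : Prop :=
  A != 0 /\ forall s T, D * s = A * T -> exists s0, s = A * s0.

Lemma cancels_mod_prime q D :
  prime_element q -> ~ divs q D -> cancels_mod D q.
Proof.
move=> [q0 _ qm] qD; split=> // s T e.
have [|//|[b ->]] := qm D s; first by exists T; rewrite e mulrC.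
by exists b; rewrite mulrC.
Qed.

Lemma cancels_mod1 D : cancels_mod D 1.
Proof. by split=> [|s T _]; [exact: oner_neq0|exists s; rewrite mul1r]. Qed.

Lemma cancels_modM D A B :
  cancels_mod D A -> cancels_mod D B -> cancels_mod D (A * B).
Proof.
move=> [A0 hA] [B0 hB]; split=> [|s T]; first by rewrite mulf_neq0.
rewrite -mulrA => /[dup] e /hA[s0 es]; rewrite es in e *.
have /hB[s1 ->] : D * s0 = B * T by apply: (mulfI A0); rewrite -e mulrCA.
by exists s1; rewrite mulrA.
Qed.

Lemma cancels_modX D A n : cancels_mod D A -> cancels_mod D (A ^+ n).
Proof.
move=> hA; elim: n => [|n IH]; first by rewrite expr0; apply: cancels_mod1.
by rewrite exprS; apply: cancels_modM.
Qed.

(** The left hand side has exponent exactly a at q as soon as q does not divide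
    s; when it does, b = 0. *)
Lemma prime_exponent_le q D s T a b :
  prime_element q -> ~ divs q D -> ((0 < b)%N -> ~ divs q s) ->
  q ^+ a * D * s = q ^+ b * T -> (b <= a)%N.
Proof.
move=> pq qD qs; have q0 := prime_element_neq0 pq.
case: leqP => // ab; rewrite -(subnKC (ltnW ab)) exprD -!mulrA.
move/(mulfI (expf_neq0 a q0)); rewrite -(subnSK ab) exprS -mulrA.
case/(proj2 (cancels_mod_prime pq qD)) => s0 es.
by case: qs; [exact: leq_trans ab|exists s0; rewrite es mulrC].
Qed.

Section ExchangedPrimes.
Variables (N : nat) (k : 'I_N).

(** What remains of the comparison of the presentations for the study of
    fractions.  The last field covers two facts: distinct members are not
    associated, and neither are y_k and y'_k. *)
Record exchanged_primes (y y' : 'I_N -> R) : Prop := ExchangedPrimes {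
  exch_prime : forall j, prime_element (y j);
  exch_eq : forall j, j != k -> y' j = y j;
  exch_divs : forall i j, divs (y j) (y' i) -> i = j /\ j <> k }.

Variables y y' : 'I_N -> R.
Hypothesis hyy' : exchanged_primes y y'.

Lemma exchanged_exponents (m m' : 'I_N -> nat) (s s' : R) :
  (forall j, (0 < m j)%N -> ~ divs (y j) s) ->
  (\prod_j y' j ^+ m' j) * s = (\prod_j y j ^+ m j) * s' ->
  m k = 0%N /\ forall j, j != k -> (m j <= m' j)%N.
Proof.
move=> hs e; split=> [|j jk].
  apply/eqP; rewrite -leqn0.
  apply: (prime_exponent_le (D := \prod_j y' j ^+ m' j)
           (T := (\prod_(j | j != k) y j ^+ m j) * s')
           (exch_prime hyy' k) _ (hs k)).
    by case/(prime_divs_prod (exch_prime hyy' k)) => i _ /(exch_divs hyy')[].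
  by rewrite expr0 mul1r e (bigD1 k) //= mulrA.
apply: (prime_exponent_le (D := \prod_(i | i != j) y' i ^+ m' i)
         (T := (\prod_(i | i != j) y i ^+ m i) * s')
         (exch_prime hyy' j) _ (hs j)).
  case/(prime_divs_prod (exch_prime hyy' j)) => i ij /(exch_divs hyy')[eij _].
  by rewrite eij eqxx in ij.
rewrite -(exch_eq hyy' jk) (bigD1 j) //= in e *.
by rewrite e (bigD1 j) //= -(exch_eq hyy' jk) !mulrA.
Qed.

Lemma exchanged_cancels (I I' : {set 'I_N}) (m m' : 'I_N -> nat) :
  cancels_mod (\prod_(j in I') y' j ^+ m' j)
    (\prod_(j in I :\: ((I :&: I') :\ k)) y j ^+ m j).
Proof.
apply: big_ind => [||j].
- exact: cancels_mod1.
- by move=> A B; apply: cancels_modM.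
rewrite !inE => /andP[jJ jI]; apply/cancels_modX/cancels_mod_prime.
  exact: exch_prime hyy' j.
case/(prime_divs_prod (exch_prime hyy' j)) => i iI' /(exch_divs hyy')[ij jk].
by case/negP: jJ; rewrite jI -ij iI' ij !andbT; apply/eqP.
Qed.

End ExchangedPrimes.

Lemma exchanged_primes_sym N (k : 'I_N) (y y' : 'I_N -> R) :
  (forall j, prime_element (y' j)) -> exchanged_primes k y y' ->
  exchanged_primes k y' y.
Proof.
move=> py' [py e h]; split=> // [j jk|i j]; first by rewrite e.
case=> b eb; have [d hd] := prime_divs_prime (py i) (py' j) eb.
have : divs (y i) (y' j) by exists d; rewrite eb mulrA hd mul1r.
by case/h => -> ik.
Qed.

End PrimeElements.

Lemma tofrac_div_eq (R : idomainType) (a b c d : R) : b != 0 -> d != 0 ->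
  tofrac a / tofrac b = tofrac c / tofrac d -> d * a = b * c.
Proof.
move=> b0 d0 /eqP; rewrite eqr_div ?tofrac_eq0 // -!tofracM tofrac_eq.
by rewrite mulrC [c * b]mulrC => /eqP.
Qed.

Lemma mpoly_unit_scalar (K : fieldType) N (a b : {mpoly K[N]}) :
  a * b = 1 -> exists c : K, b = c%:A.
Proof.
move/mpoly_intro_unit => /andP[/eqP e _].
by exists b@_0%MM; rewrite alg_mpolyC.
Qed.

(** * Localizations at monomials *)

Section Monomials.
Variables (K : fieldType) (N : nat).
Implicit Types (y : 'I_N -> {mpoly K[N]}) (I J : {set 'I_N}).

Lemma monomial_in_neq0 y I e :
  (forall j, y j != 0) -> monomial_in y I e -> e != 0.
Proof.
move=> y0 [c [m [c0 ->]]]; rewrite scaler_eq0 negb_or c0.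
by apply/prodf_neq0 => j _; apply: expf_neq0.
Qed.

Lemma monomial_in_sub y y' I J e :
  J \subset I -> {in J, y =1 y'} -> monomial_in y J e -> monomial_in y' I e.
Proof.
move=> /subsetP JI yy' [c [m [c0 ->]]].
exists c, (fun j => if j \in J then m j else 0%N); split=> //.
congr (_ *: _); rewrite [RHS](big_setID J) /= [X in _ * X]big1 ?mulr1.
  rewrite (setIidPr _); last exact/subsetP.
  by apply: eq_bigr => j jJ; rewrite jJ yy'.
by move=> j; rewrite !inE => /andP[/negPf -> _]; rewrite expr0.
Qed.

Lemma localization_sub (R : idomainType) (E F : R -> Prop) v :
  (forall e, E e -> F e) -> localization E v -> localization F v.
Proof. by move=> EF [s [e [/EF ? ->]]]; exists s, e. Qed.

Lemma localization_exchanged (k : 'I_N) y y' I I' v :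
  exchanged_primes k y y' -> (forall j, y' j != 0) ->
  localization (monomial_in y I) v -> localization (monomial_in y' I') v ->
  localization (monomial_in y ((I :&: I') :\ k)) v.
Proof.
move=> hyy' y'0 [s [e [he ->]]] [s' [e' [he' ev]]].
have y0 j : y j != 0 by apply: prime_element_neq0 (exch_prime hyy' j).
have := tofrac_div_eq (monomial_in_neq0 y0 he) (monomial_in_neq0 y'0 he') ev.
case: he he' => c [m [c0 ee]] [c' [m' [c'0 ee']]] {ev}.
set J := _ :\ k.
have JI : J \subset I.
  by apply/subsetP => j; rewrite !inE => /and3P[].
rewrite ee' ee [\prod_(j in I) _](big_setID J) /= (setIidPr JI).
set A := \prod_(j in I :\: J) _; set B := \prod_(j in J) _.
rewrite -!scalerAl => /(congr1 (fun a => c'^-1 *: a)).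
rewrite scalerA mulVf // scale1r [B * A]mulrC -mulrA !scalerAr.
have [A0 hA] := exchanged_cancels hyy' I I' m m'.
case/hA => s0 ->; exists s0, (c *: B); split; first by exists c, m.
rewrite !tofracM -mulf_div divff ?mul1r //.
by rewrite tofrac_eq0.
Qed.

End Monomials.

(** * The exchange of two consecutive variables *)

Section Exchange.
Variables (K : fieldType) (N r : nat).
Variables (br : {mpoly K[N]} -> {mpoly K[N]} -> {mpoly K[N]}).
Variables (act : {ffun 'I_r -> K} -> {mpoly K[N]} -> {mpoly K[N]}).

Section OnePresentation.
Variables (x : 'I_N -> {mpoly K[N]}) (eta : 'I_N -> int).
Variable y : 'I_N -> {mpoly K[N]}.
Hypothesis hpoly : forall i : 'I_N,
  polynomial_ext (gen x i) (x i) (gen x i.+1).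
Hypothesis htop : forall a, gen x N a.
Hypothesis hy : associated_primes br act x eta y.

Lemma assoc_prime_element (j : 'I_N) : prime_element (y j).
Proof.
have D a : divides_in (gen x N) (y j) a <-> divs (y j) a.
  by split=> [[b _ ->]|[b ->]]; exists b.
have [_ pn pm] : prime_in (gen x N) (y j).
  apply: (prime_in_top hpoly _ (assoc_prime_in hy j)).
  by rewrite ltn_ord leqnn.
split; first exact: assoc_neq0 hy j.
  by move/D.
by move=> a b /D /(pm _ _ (htop a) (htop b)) [] /D; [left|right].
Qed.

End OnePresentation.

Lemma divs_scale p q : prime_element p -> prime_element q ->
  @divs {mpoly K[N]} q p -> exists c : K, p = c *: q.
Proof.
move=> pp pq [b e].
have [d /mpoly_unit_scalar[c ec]] := prime_divs_prime pp pq e.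
by exists c; rewrite e ec -scalerAl mul1r.
Qed.

Lemma assoc_exchanged (x x' : 'I_N -> {mpoly K[N]}) (eta eta' : 'I_N -> int)
    (y y' : 'I_N -> {mpoly K[N]}) (k : 'I_N) :
  (forall i : 'I_N, polynomial_ext (gen x i) (x i) (gen x i.+1)) ->
  (forall i : 'I_N, polynomial_ext (gen x' i) (x' i) (gen x' i.+1)) ->
  (forall a, gen x N a) -> (forall a, gen x' N a) ->
  associated_primes br act x eta y -> associated_primes br act x' eta' y' ->
  (forall j, j != k -> y' j = y j) -> (forall a : K, y' k <> a *: y k) ->
  exchanged_primes k y y'.
Proof.
move=> hp hp' ht ht' hy hy' yy' ny.
have py := assoc_prime_element hp ht hy.
have py' := assoc_prime_element hp' ht' hy'.
split=> // i j /(divs_scale (py' i) (py j)) [c e].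
have [jk|jk] := eqVneq j k; last first.
  split; last exact/eqP.
  by rewrite -yy' // in e; apply: (assoc_scale_inj hp' hy' e).
rewrite jk in e; have [ik|ik] := eqVneq i k.
  by rewrite ik in e; case: (ny _ e).
have ki : i = k by rewrite yy' // in e; apply: (assoc_scale_inj hp hy e).
by rewrite ki eqxx in ik.
Qed.

End Exchange.

Theorem theorem10p3
  (K : fieldType) (hK : [pchar K] =i pred0)
  (N r : nat)
  (br : {mpoly K[N]} -> {mpoly K[N]} -> {mpoly K[N]})
  (act : {ffun 'I_r -> K} -> {mpoly K[N]} -> {mpoly K[N]})
  (x : 'I_N -> {mpoly K[N]})
  (sg dl : 'I_N -> {mpoly K[N]} -> {mpoly K[N]})
  (hR : pcgl_extension br act x sg dl)
  (k k1 : 'I_N) (hk1 : k1 = k.+1 :> nat)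
  (hdl : exists c : K, dl k1 (x k) = c%:A)
  (eta : 'I_N -> int) (y : 'I_N -> {mpoly K[N]})
  (hy : associated_primes br act x eta y)
  (heta : eta k = eta k1)
  (x' : 'I_N -> {mpoly K[N]}) (hx' : forall j, x' j = x (tperm k k1 j))
  (sg' dl' : 'I_N -> {mpoly K[N]} -> {mpoly K[N]})
  (hsgdl : forall j : 'I_N, j != k -> j != k1 ->
     forall b, gen x j b -> sg' j b = sg j b /\ dl' j b = dl j b)
  (hR' : pcgl_extension br act x' sg' dl')
  (eta' : 'I_N -> int) (y' : 'I_N -> {mpoly K[N]})
  (hy' : associated_primes br act x' eta' y') :
  [/\ forall j, j != k -> y' j = y j,
      forall (v : {fraction {mpoly K[N]}}) (m m' : 'I_N -> nat),
        v != 0 ->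
        localization (monomial_in y [set: 'I_N]) v ->
        localization (monomial_in y' [set: 'I_N]) v ->
        minimal_denominator y m v ->
        minimal_denominator y' m' v ->
        [/\ m k = 0%N, m' k = 0%N & forall j, j != k -> m j = m' j]
    & forall I I' : {set 'I_N},
        (forall v : {fraction {mpoly K[N]}},
           (localization (monomial_in y I) v /\
            localization (monomial_in y' I') v) <->
           localization (fun e => monomial_in y I e /\ monomial_in y' I' e) v)
        /\
        (forall v : {fraction {mpoly K[N]}},
           localization (fun e => monomial_in y I e /\ monomial_in y' I' e) v
           <-> localization (monomial_in y ((I :&: I') :\ k)) v)].
Proof.
have hpoly i := pore_poly (pcgl_ore hR i).
have hpoly' i := pore_poly (pcgl_ore hR' i).
have yy' := assoc_swap hk1 hx' hpoly hpoly' hy hy' heta.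
have ny := assoc_swap_neq hk1 hx' hpoly hy hy'.
have hyy' := assoc_exchanged hpoly hpoly' (pcgl_top hR) (pcgl_top hR')
  hy hy' yy' ny.
have py' := assoc_prime_element hpoly' (pcgl_top hR') hy'.
have hy'y := exchanged_primes_sym py' hyy'.
have y0 := assoc_neq0 hy; have y'0 := assoc_neq0 hy'.
split=> // [v m m' _ _ _ [s [ev hs]] [s' [ev' hs']]|I I'].
  have P0 : \prod_j y j ^+ m j != 0.
    by apply/prodf_neq0 => j _; apply: expf_neq0.
  have P'0 : \prod_j y' j ^+ m' j != 0.
    by apply/prodf_neq0 => j _; apply: expf_neq0.
  have e : (\prod_j y' j ^+ m' j) * s = (\prod_j y j ^+ m j) * s'.
    by apply: tofrac_div_eq => //; rewrite mulrC -ev ev' mulrC.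
  have [mk le] := exchanged_exponents hyy' hs e.
  have [mk' le'] := exchanged_exponents hy'y hs' (esym e).
  by split=> // j jk; apply/eqP; rewrite eqn_leq le // le'.
set J := _ :\ k.
have toJ v : localization (monomial_in y I) v ->
    localization (monomial_in y' I') v -> localization (monomial_in y J) v.
  exact: localization_exchanged hyy' y'0.
have ofJ e : monomial_in y J e -> monomial_in y I e /\ monomial_in y' I' e.
  move=> he; split; apply: monomial_in_sub he => //.
  - by apply/subsetP => j; rewrite !inE => /and3P[].
  - by apply/subsetP => j; rewrite !inE => /and3P[].
  - by move=> j; rewrite !inE => /andP[jk _]; rewrite yy'.
have left v : localization (fun e => monomial_in y I e /\ monomial_in y' I' e) v
    -> localization (monomial_in y I) v /\ localization (monomial_in y' I') v.
  by move=> h; split; apply: localization_sub h => e [].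
split=> v; split.
- by case=> h h'; apply: localization_sub (toJ v h h').
- exact: left.
- by move=> /left[h h']; apply: toJ.
- exact: localization_sub.
Qed.
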